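(* Let $b\ge 1$, $r\ge 2$ and $\alpha\in[0,1)$. Let the horizon $x$ be distributed according to a probability density $\mu$ whose support is an interval $[\ell,u]\subseteq[0,\infty)$ and which is non-decreasing on $[\ell,y]$ and non-increasing on $[y,u]$ for some $y\in[\ell,u]$. Let $t^*$ be the $\alpha$-quantile of $\mu$, i.e. $\int_0^{t^*}\mu(z)\,dz=\alpha$, and for $T\ge 0$ let $q_T=\int_T^\infty \mu(z)\,dz$. Then for every $T\in[b/(r-1),\,b(r-1)]$, $$\mathrm{CVaR}_{\alpha,\mu}[A_T(x)]=\min\left\{\frac{1}{1-\alpha}\left(\int_{t^*}^{T} z\,\mu(z)\,dz+(T+b)\,q_T\right),\ T+b\,\frac{q_T}{1-\alpha},\ T+b\right\},$$ and the threshold minimizing $\mathrm{CVaR}_{\alpha,\mu}[A_T(x)]$ (equivalently, the $r$-robust threshold of minimum $\alpha$-consistency) is $$T^*_{\mathrm{CVaR}}=\operatorname{argmin}_{T\in[b/(r-1),\,b(r-1)]}\mathrm{CVaR}_{\alpha,\mu}[A_T(x)].$$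
   Context: Continuous ski rental: buying costs $b\ge 1$, renting costs $1$ per unit time, the skiing horizon is $x>0$. For $T\ge 0$, $A_T$ buys at time $T$, with cost $A_T(x)=x$ if $x<T$ and $A_T(x)=T+b$ if $x\ge T$. For $r\ge 2$, $A_T$ is $r$-robust (i.e. $\sup_x A_T(x)/\min\{x,b\}\le r$) iff $T\in[b/(r-1),b(r-1)]$. For a random cost $X$ and $\alpha\in[0,1)$, the conditional value-at-risk is $\mathrm{CVaR}_\alpha(X)=\inf_{t\in\mathbb{R}}\{t+\frac{1}{1-\alpha}\mathbb{E}[(X-t)^+]\}$, where $(s)^+=\max\{s,0\}$; $\mathrm{CVaR}_{\alpha,\mu}$ means $x\sim\mu$. The $\alpha$-consistency of $A_T$ is $\mathrm{CVaR}_{\alpha,\mu}[A_T(x)]/\mathbb{E}_{x\sim\mu}[\min\{x,b\}]$.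
   Formalization: The integral from t* to T is taken over the set of z with t* ≤ z ≤ T, so it is 0 when T < t*; with the usual signed integral the formula fails (e.g. μ uniform on [100,200], α=1/2, b=1, r=2, T=1). *)

(* Defs.v *)
From HB Require Import structures.
From mathcomp Require Export all_boot all_order all_algebra.
From mathcomp Require Export all_classical all_reals all_analysis.
Export numFieldNormedType.Exports.

Set Implicit Arguments.
Unset Strict Implicit.
Unset Printing Implicit Defensive.

Import Order.TTheory GRing.Theory Num.Theory.

Local Open Scope classical_set_scope.
Local Open Scope ring_scope.

Section SkiRental.
Context {R : realType}.

Definition buy_cost (b T x : R) : R := if x < T then x else T + b.

Definition opt_cost (b x : R) : R := Num.min x b.

(* The supremum is taken in the extended reals: [sup] on [R] returns 0 on
   unbounded sets (e.g. for T = 0), which would make them robust. *)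
Definition robust (b r T : R) : Prop :=
  (ereal_sup [set (buy_cost b T x / opt_cost b x)%:E | x in `]0%R, +oo[] <= r%:E)%E.

Definition robust_thresholds (b r : R) : set R :=
  [set T | 0 <= T /\ robust b r T].

Definition CVaR {d : measure_display} {Omega : measurableType d}
    (P : probability Omega R) (alpha : R) (X : Omega -> R) : \bar R :=
  ereal_inf [set (t%:E + ((1 - alpha)^-1)%:E *
                  'E_P[(fun w => Num.max (X w - t) 0)%R])%E | t in [set: R]].

Definition consistency {d : measure_display} {Omega : measurableType d}
    (P : probability Omega R) (alpha b : R) (x : Omega -> R) (T : R) : \bar R :=
  (CVaR P alpha (fun w => buy_cost b T (x w)) /
   'E_P[fun w => opt_cost b (x w)])%E.

Definition probability_density (mu : R -> R) : Prop :=
  [/\ measurable_fun [set: R] mu,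
      forall z, 0 <= mu z
    & (\int[lebesgue_measure]_z (mu z)%:E = 1)%E].

Definition has_density {d : measure_display} {Omega : measurableType d}
    (P : probability Omega R) (x : {RV P >-> R}) (mu : R -> R) : Prop :=
  forall A : set R, measurable A ->
    distribution P x A = (\int[lebesgue_measure]_(z in A) (mu z)%:E)%E.

Definition closed_support (mu : R -> R) : set R := closure [set z | mu z != 0].

Definition unimodal_on (l u : R) (mu : R -> R) : Prop :=
  exists2 y : R, y \in `[l, u]
    & {in `[l, y] &, {homo mu : s t / s <= t}} /\
      {in `[y, u] &, {homo mu : s t /~ s <= t}}.

(* The argmin is a set: minimizers need not be unique. *)
Definition argmin (D : set R) (f : R -> \bar R) : set R :=
  [set T | D T /\ forall T', D T' -> (f T <= f T')%E].

End SkiRental.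

(* Main.v *)
(**
  With [k = 1 / (1 - alpha)] and [X = A_T(x)], every [t] satisfies
  [t + k E[(X - t)^+] >= t + k E[(X - t) 1_(x >= t* )] = k E[X 1_(x >= t* )],
  because the event [x >= t*] has probability [1 - alpha]. If [t* <= T] this
  bound is the first of the three terms and is attained at [t = t*]; if [T < t*]
  it is [T + b] and is attained at [t = T + b]. The three terms are the values
  of the objective at [t*], [T] and [T + b] when [t* <= T]; when [T < t*] the
  first two are at least [T + b] because [q_T >= 1 - alpha].
  The density makes [q_T] and the truncated mean continuous in [T], so a
  minimizer exists on the compact interval, and dividing by the positive finite
  [E[min(x, b)]] does not change the minimizers.
*)

From HB Require Import structures.
Require Import Defs.
From mathcomp Require Import measurable_realfun ring lra.

Set Implicit Arguments.
Unset Strict Implicit.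
Unset Printing Implicit Defensive.

Import Order.TTheory GRing.Theory Num.Theory.

Local Open Scope classical_set_scope.
Local Open Scope ring_scope.

(** * Robustness of a threshold *)

(** For [T > 0] the worst horizon is [x = T]: there [T + b <= r * min(T, b)], and the two arguments
    of the minimum give the two endpoints. For [T = 0] the ratio is unbounded near [x = 0]. *)
Lemma robust_thresholdsE (R : realType) (b r : R) : 0 < b -> 1 < r ->
  robust_thresholds b r = [set` `[b / (r - 1), b * (r - 1)]].
Proof.
move=> b0 r1; apply/seteqP; split=> [T [T0 rT]|T]/=.
  have rx x : 0 < x -> buy_cost b T x <= r * Num.min x b.
    move=> x0; rewrite -ler_pdivrMr ?lt_min ?x0//.
    rewrite -lee_fin; apply: le_trans rT.
    by apply: ereal_sup_ubound; exists x => //=; rewrite in_itv/= x0.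
  have {}T0 : 0 < T.
    rewrite lt_neqAle T0 andbT; apply/eqP => T0'.
    have r2 : 0 < r + 1 by lra.
    (* With [T = 0] the cost is always [b]; at this horizon robustness would allow at most
       [r * b / (r + 1) < b]. *)
    have := rx (b / (r + 1)); rewrite divr_gt0// => /(_ isT).
    rewrite /buy_cost -T0' ltNge (ltW (divr_gt0 b0 r2))/= add0r => h.
    have : b <= r * (b / (r + 1)).
      by apply: le_trans h _; rewrite ler_pM2l ?ge_min ?lexx//; lra.
    by rewrite mulrA ler_pdivlMr//; nra.
  have := rx T T0; rewrite /buy_cost ltxx => h.
  have r0 : 0 < r by lra.
  have h1 : T + b <= r * T by apply: le_trans h _; rewrite ler_pM2l ?ge_min ?lexx.
  have h2 : T + b <= r * b.
    by apply: le_trans h _; rewrite ler_pM2l ?ge_min ?lexx ?orbT.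
  by rewrite in_itv/= ler_pdivrMr ?subr_gt0//; nra.
rewrite in_itv/= ler_pdivrMr ?subr_gt0// => /andP[h1 h2].
have T0 : 0 < T by nra.
split; first exact: ltW.
apply: ge_ereal_sup => y /= [x]; rewrite in_itv/= andbT => x0 <-.
rewrite lee_fin ler_pdivrMr /opt_cost ?lt_min ?x0//.
by rewrite /buy_cost; case: (ltP x T) => xT; case: (leP x b) => xb; nra.
Qed.

(** * Expectations as integrals against the density *)

Section density.
Context {R : realType} {mu : R -> R}.
Hypothesis hmu : probability_density mu.
Notation leb := (@lebesgue_measure R).

Lemma measurable_density D : measurable_fun D mu.
Proof. by case: hmu => m _ _; exact: measurable_funTS. Qed.

Lemma density_ge0 z : 0 <= mu z.
Proof. by case: hmu. Qed.

Lemma integrable_density : leb.-integrable setT (EFin \o mu).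
Proof.
case: hmu => mmu mu0 mu1; apply/integrableP; split; first exact/measurable_EFinP.
by under eq_integral do rewrite /= ger0_norm//; rewrite mu1 ltry.
Qed.

Lemma integrableM_density (D : set R) (g : R -> R) (M : R) :
    measurable D -> measurable_fun D g -> (forall z, D z -> `|g z| <= M) ->
  leb.-integrable D (EFin \o (fun z => g z * mu z)).
Proof.
move=> mD mg gM.
have iM : leb.-integrable D (EFin \o (fun z => M * mu z)).
  rewrite (_ : _ \o _ = fun z => (M%:E * (EFin \o mu) z)%E); last by [].
  by apply: integrableZl => //; exact: integrableS integrable_density.
apply: le_integrable iM => //.
  by apply/measurable_EFinP/measurable_funM => //; exact: measurable_density.
move=> z Dz; rewrite lee_fin !normrM ler_wpM2r//.
by rewrite (le_trans (gM _ Dz))// ler_norm.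
Qed.

(** The Radon-Nikodym derivative of the law of [x] and [mu] have equal integrals over every
    measurable set, hence agree almost everywhere; change of variables then applies. *)
Lemma expectation_density {d : measure_display} {Omega : measurableType d}
    (P : probability Omega R) (x : {RV P >-> R}) (g : R -> R) :
  has_density x mu -> measurable_fun setT g -> (forall z, 0 <= g z) ->
  ('E_P[fun w => g (x w)] = \int[leb]_z (g z * mu z)%:E)%E.
Proof.
move=> hx mg g0.
(* [R] and [measurableTypeR R] carry the same sigma-algebra under different
   displays; Radon-Nikodym needs both measures on the latter. *)
pose GR : measurableType _ := measurableTypeR R.
pose x1 : Omega -> GR := x.
have mx1 : measurable_fun setT x1.
  by move=> mT A mA; exact: (@measurable_funPT _ _ _ _ x mT A mA).
pose x2 : {mfun Omega >-> GR} :=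
  HB.pack x1 (isMeasurableFun.Build _ _ _ _ x1 mx1).
pose nu := distribution P x2.
have numu : nu `<< leb.
  apply/null_content_dominatesP => A mA A0.
  rewrite [LHS](hx A mA) null_set_integral//.
  exact: measurable_funTS (measurable_int _ integrable_density).
pose rn := Radon_Nikodym_SigmaFinite.f nu leb.
have rnmu : ae_eq leb setT rn (EFin \o mu).
  apply: integral_ae_eq => //.
  - exact: Radon_Nikodym_SigmaFinite.f_integrable.
  - exact: measurable_int integrable_density.
  - by move=> E _ mE; rewrite -Radon_Nikodym_SigmaFinite.f_integral//; exact: hx.
have mg' : measurable_fun [set: GR] (EFin \o g) by exact/measurable_EFinP.
rewrite unlock.
transitivity (\int[nu]_z (EFin \o g) z)%E.
  by rewrite ge0_integral_distribution// => z; rewrite lee_fin.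
rewrite -(Radon_Nikodym_SigmaFinite.change_of_variables numu)//.
apply: ae_eq_integral => //.
- apply: emeasurable_funM => //.
  exact: measurable_int (Radon_Nikodym_SigmaFinite.f_integrable _).
- by apply/measurable_EFinP/measurable_funM => //; exact: measurable_density.
- apply: filterS rnmu => z /(_ I) /= rnz _.
  by rewrite -/rn rnz -EFinM.
Qed.

(** Turns the quantile condition on [[0, tstar]] into tail mass [1 - alpha], and reduces continuity
    of the tail to that of a primitive. *)
Lemma Rintegral_density_tail (T : R) : (forall z, z < 0 -> mu z = 0) ->
  \int[leb]_(z in `[T, +oo[) mu z = 1 - \int[leb]_(z in `[0, T]) mu z.
Proof.
move=> mu0; have mu1 : \int[leb]_z mu z = 1.
  by case: hmu => _ _ h; rewrite /Rintegral h.
have split : \int[leb]_z mu z =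
    \int[leb]_(z in `]-oo, T[) mu z + \int[leb]_(z in `[T, +oo[) mu z.
  rewrite -(@itv_setU_setT _ R true T) Rintegral_setU//.
    by rewrite itv_setU_setT; exact: integrable_density.
  apply/disj_setPS => z [] /=; rewrite !in_itv/= andbT => zT Tz.
  by move: zT; rewrite ltNge Tz.
rewrite -mu1 split Rintegral_itv_bndo_bndc; last first.
  exact: integrableS integrable_density.
suff -> : \int[leb]_(z in `]-oo, T]) mu z = \int[leb]_(z in `[0, T]) mu z.
  by lra.
rewrite Rintegral_mkcond [RHS]Rintegral_mkcond; apply: eq_Rintegral => z _.
rewrite !patchE !mem_setE !in_itv/=; case: (leP 0 z) => //= z0.
by rewrite mu0//; case: ifP.
Qed.

Lemma measurable_buy_cost (b T : R) D : measurable_fun D (buy_cost b T).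
Proof.
apply: measurable_funTS; apply: measurable_fun_ifT => //.
exact: measurable_fun_ltr.
Qed.

(** * The CVaR objective of a fixed threshold *)

Section excess.
Variables (b T : R).
Hypothesis b0 : 0 <= b.

Let excess t := \int[leb]_z (Num.max (buy_cost b T z - t) 0 * mu z).

Let mexcess t D : measurable_fun D (fun z => Num.max (buy_cost b T z - t) 0).
Proof.
apply: measurable_funTS; apply: measurable_maxr => //.
by apply: measurable_funB => //; exact: measurable_buy_cost.
Qed.

Let iexcess t D : measurable D -> leb.-integrable D
  (EFin \o (fun z => Num.max (buy_cost b T z - t) 0 * mu z)).
Proof.
move=> mD; apply: (@integrableM_density _ _ (`|T| + b + `|t|)) => // z _.
rewrite ger0_norm ?le_max ?lexx ?orbT// ge_max.
have /andP[t1 t2] : - `|t| <= t <= `|t| by rewrite -ler_norml.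
have /andP[T1 T2] : - `|T| <= T <= `|T| by rewrite -ler_norml.
by move: b0; rewrite /buy_cost; case: ltP => zT; lra.
Qed.

Let ibuy s :
  leb.-integrable `[s, +oo[ (EFin \o (fun z => buy_cost b T z * mu z)).
Proof.
apply: (@integrableM_density _ _ (`|s| + `|T| + b)) => //.
  exact: measurable_buy_cost.
move=> z /=; rewrite in_itv/= andbT => sz; rewrite ler_norml.
have := ler_norm T; have := ler_norm (- T); rewrite normrN.
have := ler_norm s; have := ler_norm (- s); rewrite normrN.
have := normr_ge0 T; have := normr_ge0 s.
by move: b0; rewrite /buy_cost; case: ltP => zT; lra.
Qed.

Let icst (c s : R) : leb.-integrable `[s, +oo[ (EFin \o (fun z => c * mu z)).
Proof. by apply: (@integrableM_density _ _ `|c|). Qed.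

Let tail s := \int[leb]_(z in `[s, +oo[) mu z.

Let tail_buyB s t :
  \int[leb]_(z in `[s, +oo[) ((buy_cost b T z - t) * mu z) =
  \int[leb]_(z in `[s, +oo[) (buy_cost b T z * mu z) - t * tail s.
Proof.
rewrite -RintegralZl//; last exact: integrableS integrable_density.
rewrite -RintegralB//.
by apply: eq_Rintegral => z _; rewrite mulrBl.
Qed.

(** The positive part dominates both [X - t], used for [z >= s], and [0], used for [z < s]. *)
Let excess_ge s t :
  \int[leb]_(z in `[s, +oo[) (buy_cost b T z * mu z) - t * tail s <= excess t.
Proof.
rewrite -tail_buyB Rintegral_mkcond; apply: le_Rintegral => //.
- rewrite -restrict_EFin; apply/integrable_restrict => //; rewrite setTI.
  have -> : (EFin \o fun z => (buy_cost b T z - t) * mu z) =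
      ((EFin \o fun z => (buy_cost b T z * mu z)%R) \-
       (EFin \o fun z => (t * mu z)%R))%E.
    by apply/funext => z/=; rewrite mulrBl.
  exact: integrableB.
- exact: iexcess.
- move=> z _; rewrite patchE; have mu0 := density_ge0 z; case: ifP => _.
    by rewrite ler_wpM2r// le_max lexx.
  by rewrite mulr_ge0// le_max lexx orbT.
Qed.

(** Equality in [excess_ge] at [t = s]: since [s <= T], the cost is at least [s] exactly when the
    horizon is. *)
Let excess_quantile s : s <= T ->
  excess s = \int[leb]_(z in `[s, +oo[) (buy_cost b T z * mu z) - s * tail s.
Proof.
move=> sT; rewrite -tail_buyB [RHS]Rintegral_mkcond; apply: eq_Rintegral => z _.
rewrite patchE mem_setE in_itv/= andbT; case: leP => sz.
  congr (_ * _); apply/max_idPl; rewrite subr_ge0 /buy_cost.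
  by move: b0; case: ltP => zT //; lra.
rewrite (_ : Num.max _ _ = 0) ?mul0r//; apply/max_idPr.
by rewrite /buy_cost (lt_le_trans sz sT); lra.
Qed.

Let excess_threshold : excess T = b * tail T.
Proof.
rewrite -RintegralZl//; last exact: integrableS integrable_density.
rewrite [RHS]Rintegral_mkcond; apply: eq_Rintegral => z _.
rewrite patchE mem_setE in_itv/= andbT /buy_cost; case: ltP => zT.
  by rewrite (_ : Num.max _ _ = 0) ?mul0r//; apply/max_idPr; lra.
by congr (_ * _); rewrite addrC addKr; apply/max_idPl.
Qed.

Let excess_max : excess (T + b) = 0.
Proof.
rewrite /excess (_ : (fun z => _) = cst 0); first by rewrite Rintegral_cst// mul0r.
apply/funext => z; rewrite (_ : Num.max _ _ = 0) ?mul0r//; apply/max_idPr.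
by move: b0; rewrite /buy_cost; case: ltP => zT; lra.
Qed.

Let tail_buy_le s : s <= T ->
  \int[leb]_(z in `[s, +oo[) (buy_cost b T z * mu z) =
  \int[leb]_(z in `[s, T]) (z * mu z) + (T + b) * tail T.
Proof.
move=> sT.
rewrite (@itv_bndbnd_setU _ _ (BLeft s) (BLeft T) +oo%O)//.
rewrite Rintegral_setU//; last 2 first.
- by rewrite -itv_bndbnd_setU.
- apply/disj_setPS => z [] /=; rewrite !in_itv/= andbT => /andP[_ zT] Tz.
  by move: zT; rewrite ltNge Tz.
congr (_ + _).
  (* At [z = T] the cost already jumps to [T + b], so this null endpoint is dropped before the cost
     is replaced by [z]. *)
  rewrite -Rintegral_itv_bndo_bndc; last first.
    apply: (@integrableM_density _ _ (`|s| + `|T|)) => //.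
    move=> z /=; rewrite in_itv/= => /andP[sz zT]; rewrite ler_norml.
    have := ler_norm T; have := ler_norm (- T); rewrite normrN.
    have := ler_norm s; have := ler_norm (- s); rewrite normrN.
    by have := normr_ge0 T; have := normr_ge0 s; lra.
  apply: eq_Rintegral => z; rewrite mem_setE in_itv/= => /andP[_ zT].
  by rewrite /buy_cost zT.
rewrite -RintegralZl//; last exact: integrableS integrable_density.
apply: eq_Rintegral => z; rewrite mem_setE in_itv/= andbT => Tz.
by rewrite /buy_cost ltNge Tz.
Qed.

Let tail_buy_ge s : T <= s ->
  \int[leb]_(z in `[s, +oo[) (buy_cost b T z * mu z) = (T + b) * tail s.
Proof.
move=> Ts; rewrite -RintegralZl//; last exact: integrableS integrable_density.
apply: eq_Rintegral => z; rewrite mem_setE in_itv/= andbT => sz.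
by rewrite /buy_cost ltNge (le_trans Ts sz).
Qed.

Let tail_nincr s : T <= s -> tail s <= tail T.
Proof.
move=> Ts; rewrite /tail Rintegral_mkcond [leRHS]Rintegral_mkcond.
apply: le_Rintegral => //.
- rewrite -restrict_EFin; apply/integrable_restrict => //; rewrite setTI.
  exact: integrableS integrable_density.
- rewrite -restrict_EFin; apply/integrable_restrict => //; rewrite setTI.
  exact: integrableS integrable_density.
- move=> z _; rewrite !patchE !mem_setE !in_itv/= !andbT; have mu0 := density_ge0 z.
  by case: (leP s z) => sz; case: (leP T z) => // Tz; lra.
Qed.

Lemma CVaR_buy_costE {d : measure_display} {Omega : measurableType d}
    (P : probability Omega R) (x : {RV P >-> R}) (alpha tstar : R) :
    has_density x mu -> alpha < 1 -> 0 <= T ->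
    \int[leb]_(z in `[tstar, +oo[) mu z = 1 - alpha ->
  CVaR P alpha (fun w => buy_cost b T (x w)) =
  (Num.min (Num.min
     ((1 - alpha)^-1 * (\int[leb]_(z in `[tstar, T]) (z * mu z) +
                        (T + b) * \int[leb]_(z in `[T, +oo[) mu z))
     (T + b * (\int[leb]_(z in `[T, +oo[) mu z / (1 - alpha))))
     (T + b))%:E.
Proof.
move=> hx a1 T0 tailE; rewrite -/(tail tstar) -/(tail T) in tailE *.
have k0 : 0 < (1 - alpha)^-1 by rewrite invr_gt0 subr_gt0.
have kE : (1 - alpha)^-1 * (1 - alpha) = 1 by rewrite mulVf// gt_eqF// subr_gt0.
set k := (1 - alpha)^-1 in k0 kE *.
pose J t := t + k * excess t.
have -> : CVaR P alpha (fun w => buy_cost b T (x w)) =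
    ereal_inf [set (J t)%:E | t in setT].
  rewrite /CVaR; congr ereal_inf; apply: eq_imagel => t _.
  rewrite (@expectation_density _ _ _ x
    (fun z => Num.max (buy_cost b T z - t) 0))//; last first.
    by move=> z; rewrite le_max lexx orbT.
  rewrite /J EFinD EFinM; congr (_ + _ * _)%E.
  by rewrite /excess /Rintegral fineK// integrable_fin_num//; exact: iexcess.
have JT : J T = T + b * (tail T * k) by rewrite /J excess_threshold; ring.
have JTb : J (T + b) = T + b by rewrite /J excess_max mulr0 addr0.
(* The tail mass at [tstar] is [1 - alpha], the inverse of [k], so [t] cancels and the lower bound
   is uniform in [t]. *)
have J_ge t : k * \int[leb]_(z in `[tstar, +oo[) (buy_cost b T z * mu z) <= J t.
  have := excess_ge tstar t; rewrite -(ler_pM2l k0) tailE /J.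
  move: (excess t) (\int[leb]_(z in `[tstar, +oo[) _) => E B h.
  have : k * (t * (1 - alpha)) = t by rewrite mulrCA kE mulr1.
  by lra.
rewrite -JT -[X in Num.min _ X]JTb.
have inf_eq v s : (forall t, v <= J t) -> J s = v ->
    ereal_inf [set (J t)%:E | t in setT] = v%:E.
  move=> vJ Js; apply/eqP; rewrite eq_le; apply/andP; split.
    by apply: ereal_inf_lbound; exists s => //; rewrite Js.
  by apply: le_ereal_inf_tmp => _ [t _ <-]; rewrite lee_fin.
case: (leP tstar T) => tT.
  have Jt : J tstar =
      k * (\int[leb]_(z in `[tstar, T]) (z * mu z) + (T + b) * tail T).
    rewrite /J (excess_quantile tT) tail_buy_le// tailE mulrBr.
    by rewrite [k * (tstar * _)]mulrCA kE; lra.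
  have {}J_ge t : J tstar <= J t by rewrite Jt -tail_buy_le.
  rewrite -Jt (inf_eq (J tstar) tstar)//; congr EFin.
  (* The other two terms are [J T] and [J (T + b)], hence no smaller than [J tstar]. *)
  by rewrite !min_l.
have tT' := ltW tT.
have {}J_ge t : T + b <= J t.
  by apply: le_trans (J_ge t); rewrite tail_buy_ge// tailE mulrCA kE mulr1.
rewrite (inf_eq (T + b) (T + b))//; congr EFin.
rewrite JTb [RHS]min_r// le_min J_ge andbT.
(* For [T < tstar] the interval is empty, and [k * tail T >= 1] keeps the first term above
   [T + b]. *)
rewrite set_itv_ge ?Rintegral_set0 ?add0r; last by rewrite bnd_simp -ltNge.
have := ler_wpM2l (ltW k0) (tail_nincr tT'); rewrite tailE kE => h.
by rewrite mulrCA ler_peMr// addr_ge0.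
Qed.

End excess.
End density.

(** * Ingredients for existence and comparison of minimizers *)

(** [s] may lie anywhere relative to [[a, c]]. Integrating [f] cut to [[s, +oo[] from [min s a]
    gives the same values, including [0] for [T < s], as a primitive with base point at most [a]. *)
Lemma continuous_Rintegral_itv (R : realType) (f : R -> R) (s a c : R) :
    a <= c ->
    lebesgue_measure.-integrable `[Num.min s a, c] (EFin \o f) ->
  {within `[a, c], continuous
     (fun T => \int[lebesgue_measure]_(z in `[s, T]) f z)}.
Proof.
move=> ac intf.
have -> : (fun T => \int[lebesgue_measure]_(z in `[s, T]) f z) =
    (fun T => \int[lebesgue_measure]_(z in `[Num.min s a, T])
       (f \_ `[s, +oo[) z).
  apply/funext => T; rewrite -Rintegral_mkcondr; congr Rintegral.
  apply/seteqP; split => z /=; rewrite !in_itv/= ge_min andbT.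
    by move=> /andP[-> ->].
  by move=> [/andP[_ ->] ->].
apply: continuous_subspaceW; last first.
  apply: (@parameterized_integral_continuous _ (Num.min s a) c).
    by rewrite ge_min ac orbT.
  rewrite -restrict_EFin; apply/integrable_restrict => //.
  by apply: integrableS intf => //; exact: measurableI.
by move=> z /=; rewrite !in_itv/= ge_min => /andP[-> ->]; rewrite orbT.
Qed.

(** Makes the denominator of the consistency a positive real. Were it zero, [g * mu] would vanish
    almost everywhere; as [g > 0] on positive horizons, so would [mu], against total mass one. *)
Lemma expectation_opt_cost (R : realType) (mu : R -> R)
    {d : measure_display} {Omega : measurableType d}
    (P : probability Omega R) (x : {RV P >-> R}) (b : R) :
    probability_density mu -> has_density x mu -> 0 < b ->
    (forall z, z < 0 -> mu z = 0) ->
  exists2 e : R, 0 < e & ('E_P[fun w => opt_cost b (x w)] = e%:E)%E.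
Proof.
move=> hmu hx b0 mu0; pose g z : R := Num.max (opt_cost b z) 0.
have mopt : measurable_fun setT (opt_cost b) by exact: measurable_minr.
have mg : measurable_fun setT g by exact: measurable_maxr.
have g0 z : 0 <= g z by rewrite /g le_max lexx orbT.
(* Negative horizons have probability zero, so the cost may be replaced by its positive part, as
   [expectation_density] requires. *)
have Eg : ('E_P[fun w => opt_cost b (x w)] = 'E_P[fun w => g (x w)])%E.
  rewrite unlock; apply: ae_eq_integral => //.
  - by apply/measurable_EFinP; exact: measurableT_comp.
  - by apply/measurable_EFinP; exact: measurableT_comp.
  - exists (x @^-1` `]-oo, 0[); split.
    + by rewrite -[X in measurable X]setTI; exact: measurable_funPT.
    + rewrite [LHS](hx `]-oo, 0[%classic)//; apply: integral0_eq => z /=.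
      by rewrite in_itv/= => /mu0 ->.
    + move=> w /= xw; rewrite in_itv/= ltNge; apply/negP => x0; apply: xw => _.
      by rewrite /g max_l// le_min x0 ltW.
rewrite Eg (expectation_density hmu hx mg g0).
have ig : lebesgue_measure.-integrable setT (EFin \o fun z => g z * mu z).
  apply: (@integrableM_density _ _ hmu _ _ b) => // z _.
  by rewrite ger0_norm// ge_max ge_min lexx orbT ltW.
have fin := integrable_fin_num measurableT ig.
exists (\int[lebesgue_measure]_z (g z * mu z)); last by rewrite fineK.
have muge0 := density_ge0 hmu.
rewrite -lte_fin fineK// lt_neqAle integral_ge0 ?andbT; last first.
  by move=> z _; rewrite lee_fin mulr_ge0.
apply/eqP => I0.
have : ae_eq lebesgue_measure setT (EFin \o fun z => g z * mu z) (cst 0%E).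
  apply/ae_eq_integral_abs => //; first exact: measurable_int ig.
  by rewrite [RHS]I0; apply: eq_integral => z _ /=; rewrite ger0_norm// mulr_ge0.
move=> gmu0.
(* [g] vanishes at [0] and says nothing about [mu] there; that point is null. *)
have nz : {ae @lebesgue_measure R, forall z, z != 0}.
  exists [set 0]; split => //; first exact: lebesgue_measure_set1.
  by move=> z /= /negP; rewrite negbK => /eqP.
case: (hmu) => _ _ mu1.
have : (\int[lebesgue_measure]_z (mu z)%:E = 0 :> \bar R)%E.
  rewrite -(integral0 (@lebesgue_measure R) setT); apply: ae_eq_integral => //.
    exact: measurable_int (integrable_density hmu).
  apply: filterS2 gmu0 nz => z /(_ I) /= [] gz z0 _.
  have [z0'|z0'|z0'] := ltgtP z 0.
  - by rewrite mu0.
  - congr EFin; move/eqP: gz; rewrite mulf_eq0 gt_eqF//=; first by move/eqP.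
    by rewrite /g lt_max lt_min z0' b0.
  - by move: z0; rewrite z0' eqxx.
by rewrite mu1 => /eqP; rewrite onee_eq0.
Qed.

Lemma eq_argmin (R : realType) (D : set R) (f g : R -> \bar R) :
  (forall T T', D T -> D T' -> (f T <= f T')%E = (g T <= g T')%E) ->
  argmin D f = argmin D g.
Proof.
move=> fg; apply/seteqP; split=> T [DT minT]; split=> // T' DT'.
  by rewrite -fg// minT.
by rewrite fg// minT.
Qed.

(** * The closed formula and the optimal thresholds *)

Theorem theorem2 (R : realType) (b r alpha : R)
    (hb : 1 <= b) (hr : 2 <= r) (ha : 0 <= alpha < 1)
    (d : measure_display) (Omega : measurableType d) (P : probability Omega R)
    (x : {RV P >-> R}) (mu : R -> R) (l u : R)
    (hmu : probability_density mu) (hx : has_density x mu)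
    (hl : 0 <= l) (hlu : l <= u)
    (hsupp : closed_support mu = [set` `[l, u]])
    (hmode : unimodal_on l u mu)
    (tstar : R)
    (htstar : \int[lebesgue_measure]_(z in `[0, tstar]) mu z = alpha) :
  let q (T : R) : R := \int[lebesgue_measure]_(z in `[T, +oo[) mu z in
  let I : set R := [set` `[b / (r - 1), b * (r - 1)]] in
  let cvar (T : R) : \bar R := CVaR P alpha (fun w => buy_cost b T (x w)) in
  (* the integral from tstar to T is over the set of z with tstar <= z <= T;
     it is 0 when T < tstar *)
  (forall T : R, I T ->
     cvar T =
       (Num.min
          (Num.min
             ((1 - alpha)^-1 *
                (\int[lebesgue_measure]_(z in `[tstar, T]) (z * mu z)
                 + (T + b) * q T))
             (T + b * (q T / (1 - alpha))))
          (T + b))%:E)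
  /\ argmin I cvar !=set0
  /\ argmin (robust_thresholds b r) cvar = argmin I cvar
  /\ argmin (robust_thresholds b r) (consistency P alpha b x) = argmin I cvar.
Proof.
move=> q I cvar; case/andP: ha => _ a1.
have b0 : 0 < b by lra.
have r1 : 0 < r - 1 by lra.
have mu0 z : z < 0 -> mu z = 0.
  move=> z0; apply/eqP/negPn/negP => muz.
  have : closed_support mu z by exact: subset_closure.
  by rewrite hsupp/= in_itv/= => /andP[]; lra.
pose V T := Num.min (Num.min
    ((1 - alpha)^-1 *
       (\int[lebesgue_measure]_(z in `[tstar, T]) (z * mu z) + (T + b) * q T))
    (T + b * (q T / (1 - alpha)))) (T + b).
have cvarE T : I T -> cvar T = (V T)%:E.
  rewrite /I/= in_itv/= => /andP[lT _].
  apply: CVaR_buy_costE => //; first exact: ltW.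
    by apply: le_trans lT; rewrite divr_ge0// ltW.
  by rewrite Rintegral_density_tail// htstar.
split=> //; split; last first.
  rewrite robust_thresholdsE//; last lra.
  split=> //.
  have [e e0 Ee] := expectation_opt_cost hmu hx b0 mu0.
  apply: eq_argmin => T T' IT IT'; rewrite /consistency -/(cvar T) -/(cvar T').
  (* Consistency is [cvar] scaled by the positive constant [e^-1], which preserves the order. *)
  by rewrite Ee !cvarE// inver gt_eqF// -!EFinM !lee_fin ler_pM2r// invr_gt0.
pose a := b / (r - 1); pose c := b * (r - 1).
have ac : a <= c.
  have r2 : 1 <= r - 1 by lra.
  by rewrite /a /c ler_pdivrMr// -mulrA ler_peMr ?mulr_ege1// ltW.
have cq : {within `[a, c], continuous q}.
  have -> : q = fun T => 1 - \int[lebesgue_measure]_(z in `[0, T]) mu z.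
    by apply/funext => T; rewrite /q Rintegral_density_tail.
  move=> T; apply: cvgB; first exact: cvg_cst.
  apply: continuous_Rintegral_itv => //.
  exact: integrableS (integrable_density hmu).
have cz : {within `[a, c], continuous
    fun T => \int[lebesgue_measure]_(z in `[tstar, T]) (z * mu z)}.
  apply: continuous_Rintegral_itv => //.
  apply: (@integrableM_density _ _ hmu _ _ (`|Num.min tstar a| + `|c|)) => // z /=.
  rewrite in_itv/= => /andP[z1 z2]; rewrite ler_norml.
  have /andP[] : - `|c| <= c <= `|c| by rewrite -ler_norml.
  have /andP[] : - `|Num.min tstar a| <= Num.min tstar a <= `|Num.min tstar a|.
    by rewrite -ler_norml.
  by lra.
have cT : {within `[a, c], continuous (fun T : R => T)}.
  by apply: continuous_subspaceT => T; exact: cvg_id.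
have cV : {within `[a, c], continuous V}.
  have cD : {within `[a, c], continuous (fun T : R => T + b)}.
    by move=> T; apply: cvgD; [exact: cT|exact: cvg_cst].
  move=> T; apply: (@continuous_min _ _ (fun T => Num.min _ _) _ T); last exact: cD.
  apply: (@continuous_min _ _ (fun T => _ * _) (fun T => _ + _) T).
    apply: cvgM; first exact: cvg_cst.
    by apply: cvgD; [exact: cz|apply: cvgM; [exact: cD|exact: cq]].
  apply: cvgD; first exact: cT.
  by apply: cvgM; [exact: cvg_cst|apply: cvgM; [exact: cq|exact: cvg_cst]].
(* The continuous [V] attains its minimum on the compact interval, where it equals [cvar]. *)
have [T IT minT] := EVT_min ac cV.
exists T; split=> // T' IT'.
by rewrite !cvarE// lee_fin minT.
Qed.
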